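(* Let $\rho$ be any positive integer. Every integer $n$ with $n\ge 550\rho^2$ is a sum of at most four squares of integers in $S_\rho$, i.e. there exist $k\le 4$ and $x_1,\dots,x_k\in S_\rho$ with $n=x_1^2+\cdots+x_k^2$.
   Context: For a positive integer $\rho$, $S_\rho=\{n\in\mathbb{Z} : n\ge 0,\ n\neq\rho\}$. *)

(* Defs.v *)
From mathcomp Require Import all_boot all_order all_algebra.
Set Implicit Arguments.
Unset Strict Implicit.
Unset Printing Implicit Defensive.
Import Order.TTheory GRing.Theory Num.Theory.
Local Open Scope ring_scope.

Definition S_ (rho : int) : {pred int} := [pred n : int | (0 <= n) && (n != rho)].

(* Main.v *)
(* Start from any representation of n as a sum of four squares (Lagrange) and
   assume that every representation of n has an entry rho or - rho.  If v has
   entries in {0, 1, -1}, exactly three of them nonzero, and 3 divides x . v,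
   then the reflection x - (2 (x . v) / 3) v is another integral representation
   of n.  Its having an entry rho or - rho is a linear condition on x.
   Depending on n, rho and x modulo 3 there are enough such reflections for
   these conditions to force x into a finite set of multiples of rho, all of
   norm at most 475 rho^2; in the few degenerate cases where a line survives,
   a second reflection cuts it down.  Only x = (b, 3y) with b prime to 3 resists,
   but there 9 |y|^2 is also a sum of three squares prime to 3.  Finally, if 9
   divides n and 3 divides rho, then divide n by 9 and rho by 3. *)
Require Import Defs.
From mathcomp Require Import all_boot all_order all_algebra.
From mathcomp Require Import zify ring.
Set Implicit Arguments.
Unset Strict Implicit.
Unset Printing Implicit Defensive.
Import Order.TTheory GRing.Theory Num.Theory.
Local Open Scope ring_scope.

Lemma sqr_le_of_between (k x : int) : - k <= x <= k -> x ^+ 2 <= k ^+ 2.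
Proof.
move=> xk; have : 0 <= (k - x) * (k + x) by apply: mulr_ge0; lia.
lia.
Qed.

(** * Lagrange's four-square theorem *)

Definition sum4sq (n : int) : Prop :=
  exists x y z w : int, x ^+ 2 + y ^+ 2 + z ^+ 2 + w ^+ 2 = n.

Lemma sum4sqM (m n : int) : sum4sq m -> sum4sq n -> sum4sq (m * n).
Proof.
move=> [x [y [z [w <-]]]] [a [b [c [d <-]]]].
exists (x * a + y * b + z * c + w * d), (x * b - y * a + z * d - w * c),
  (x * c - y * d - z * a + w * b), (x * d + y * c - z * b - w * a).
ring.
Qed.

Lemma prime_dvd_sqrD1 (p : nat) : prime p -> odd p ->
  exists a b : nat,
    [/\ (a.*2 < p)%N, (b.*2 < p)%N & (p %| a ^ 2 + b ^ 2 + 1)%N].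
Proof.
move=> p_pr p_odd; pose k := p./2.
have pE : p = k.*2.+1 by rewrite -[LHS]odd_double_half p_odd.
have natF (m : nat) : (m%:R == 0 :> 'F_p) = (p %| m)%N.
  by rewrite (dvdn_pcharf (pchar_Fp p_pr)).
have sqr_inj (a b : 'I_k.+1) : a%:R ^+ 2 = b%:R ^+ 2 :> 'F_p -> a = b.
  move=> /eqP; rewrite eqf_sqr => /orP[]; last first.
    rewrite -addr_eq0 -natrD natF => /dvdnP [[|j] abE]; apply/val_inj => /=.
      by lia.
    by have := ltn_ord a; have := ltn_ord b; nia.
  wlog le_ba : a b / (b <= a)%N => [th|].
    case: (leqP b a) => [/th //|/ltnW/th ba]; rewrite eq_sym => /ba //.
  rewrite -subr_eq0 -natrB // natF => /dvdnP [[|j] abE]; apply/val_inj => /=.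
    by lia.
  by have := ltn_ord a; have := ltn_ord b; nia.
pose f (u : 'I_k.+1 + 'I_k.+1) : 'F_p :=
  match u with inl a => a%:R ^+ 2 | inr b => - 1 - b%:R ^+ 2 end.
have /injectivePn [u [v neq_uv]] : ~~ injectiveb f.
  apply/injectiveP => /leq_card; rewrite card_sum card_Fp // !card_ord.
  by lia.
have meet (a b : 'I_k.+1) : a%:R ^+ 2 = - 1 - b%:R ^+ 2 :> 'F_p ->
    exists a b : nat,
      [/\ (a.*2 < p)%N, (b.*2 < p)%N & (p %| a ^ 2 + b ^ 2 + 1)%N].
  move=> abE; exists a, b; split.
  - by have := ltn_ord a; lia.
  - by have := ltn_ord b; lia.
  - by rewrite -natF !natrD !natrX abE; apply/eqP; ring.
case: u v neq_uv => [a|a] [b|b] /= neq_ab.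
- by move/sqr_inj => ab; rewrite ab eqxx in neq_ab.
- exact: meet.
- by move=> /esym; exact: meet.
- by move=> /addrI /oppr_inj /sqr_inj ab; rewrite ab eqxx in neq_ab.
Qed.

Lemma balanced_residue (m : nat) (x : int) : (0 < m)%N ->
  exists a u : int, x = a + m%:Z * u /\ - m%:Z < 2 * a <= m.
Proof.
move=> m_gt0; pose m2 := 2 * m%:Z; pose y := 2 * x + m%:Z - 1.
have m2_gt0 : 0 < m2 by rewrite /m2; lia.
have y_ge := modz_ge0 y (lt0r_neq0 m2_gt0); have y_lt := ltz_pmod y m2_gt0.
exists (x - m%:Z * (y %/ m2)%Z), (y %/ m2)%Z; split; first ring.
move: (divz_eq y m2) y_ge y_lt; rewrite {1}/y /m2.
move: (y %/ _)%Z (y %% _)%Z => u r; clear; lia.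
Qed.

Lemma sum4sq_descent (p m : nat) : prime p -> (0 < m < p)%N ->
  sum4sq (m * p)%N -> sum4sq p.
Proof.
move=> p_pr; have [k] := ubnP m.
elim: k m => // k IH m lt_mk /andP[m_gt0 lt_mp].
case: (eqVneq m 1%N) => [->|m1]; first by rewrite mul1n.
have m_ndvd (j : int) : m%:Z * j != p.
  apply/eqP => mj; have : (m %| p)%N.
    by rewrite -[(_ %| _)%N]/(m%:Z %| p%:Z)%Z -mj dvdz_mulr.
  case/primeP: p_pr => _ /[apply] /orP[|/eqP m_p]; first by rewrite (negPf m1).
  by rewrite m_p ltnn in lt_mp.
case=> [x [y [z [w E]]]].
have [a [u [xE a_m]]] := balanced_residue x m_gt0.
have [b [v [yE b_m]]] := balanced_residue y m_gt0.
have [c [s [zE c_m]]] := balanced_residue z m_gt0.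
have [d [t [wE d_m]]] := balanced_residue w m_gt0.
pose m' := p%:Z - 2 * (a * u + b * v + c * s + d * t)
  - m%:Z * (u ^+ 2 + v ^+ 2 + s ^+ 2 + t ^+ 2).
have mE : a ^+ 2 + b ^+ 2 + c ^+ 2 + d ^+ 2 = m%:Z * m'.
  by rewrite /m' !mulrBr -PoszM -E xE yE zE wE; ring.
have sqr_ub (e : int) : - m%:Z < 2 * e <= m ->
    4 * e ^+ 2 <= m%:Z ^+ 2 /\ (4 * e ^+ 2 = m%:Z ^+ 2 -> 2 * e = m).
  move=> e_m; split.
    by clear -e_m; have := @sqr_le_of_between m (2 * e); lia.
  have -> : 4 * e ^+ 2 = (2 * e) ^+ 2 by ring.
  move/eqP; rewrite eqf_sqr => /orP[] /eqP; clear -e_m; lia.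
have [[a2 a2m] [b2 b2m]] := (sqr_ub a a_m, sqr_ub b b_m).
have [[c2 c2m] [d2 d2m]] := (sqr_ub c c_m, sqr_ub d d_m).
have [a0 b0 c0 d0] := And4 (sqr_ge0 a) (sqr_ge0 b) (sqr_ge0 c) (sqr_ge0 d).
have m'_ge0 : 0 <= m'.
  rewrite -(pmulr_rge0 _ (_ : 0 < m%:Z)) -?mE;
    by clear -a0 b0 c0 d0 a2 b2 c2 d2 m_gt0; lia.
have m'_le : m' <= m.
  rewrite -(ler_pM2l (_ : 0 < m%:Z)) -?mE;
    by clear -a0 b0 c0 d0 a2 b2 c2 d2 m_gt0; lia.
have [m'0|m'_neq0] := eqVneq m' 0.
  have sum0 : a ^+ 2 + b ^+ 2 + c ^+ 2 + d ^+ 2 = 0 by rewrite mE m'0 mulr0.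
  have sqr0 (e : int) : e ^+ 2 <= 0 -> e = 0.
    by move=> e0; apply/eqP; rewrite -sqrf_eq0 eq_le e0 sqr_ge0.
  have [a00 b00] : a = 0 /\ b = 0.
    by split; apply: sqr0; clear -sum0 a0 b0 c0 d0; lia.
  have [c00 d00] : c = 0 /\ d = 0.
    by split; apply: sqr0; clear -sum0 a0 b0 c0 d0; lia.
  case/eqP: (m_ndvd (u ^+ 2 + v ^+ 2 + s ^+ 2 + t ^+ 2)).
  move: m'0; rewrite /m' a00 b00 c00 d00 !mul0r !addr0.
  by move/subr0_eq/esym.
have [m'm|m'_neqm] := eqVneq m' m.
  have sumE : a ^+ 2 + b ^+ 2 + c ^+ 2 + d ^+ 2 = m%:Z ^+ 2 by rewrite mE m'm.
  have [{}a2m {}b2m] : 2 * a = m /\ 2 * b = m.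
    by split; [apply: a2m | apply: b2m]; clear -sumE a2 b2 c2 d2; lia.
  have [{}c2m {}d2m] : 2 * c = m /\ 2 * d = m.
    by split; [apply: c2m | apply: d2m]; clear -sumE a2 b2 c2 d2; lia.
  pose S := u ^+ 2 + v ^+ 2 + s ^+ 2 + t ^+ 2.
  case/eqP: (m_ndvd (1 + (u + v + s + t) + S)).
  rewrite /S !mulrDr mulr1 -{1}m'm /m' !mulrDr !mulrA a2m b2m c2m d2m; ring.
clearbody m'; have [j jE] : exists j : nat, m' = j.
  by exists `|m'|%N; rewrite gez0_abs.
apply: (IH j).
- by clear -jE m'_le m'_neqm lt_mk; lia.
- by clear -jE m'_neq0 m'_le lt_mp; lia.
exists (m' + a * u + b * v + c * s + d * t), (u * b - v * a + s * d - t * c),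
  (u * c - v * d - s * a + t * b), (u * d + v * c - s * b - t * a).
apply: (@mulfI _ (m%:Z ^+ 2)); first by clear -m_gt0; lia.
have mXE : m%:Z * (m' + a * u + b * v + c * s + d * t) =
    x * a + y * b + z * c + w * d.
  by rewrite !mulrDr -mE xE yE zE wE; ring.
have -> : m%:Z ^+ 2 * (j * p)%N = (m%:Z * m') * (m * p)%N.
  by rewrite jE !PoszM; ring.
rewrite -mE -E !mulrDr -!exprMn -!mulrDr mXE xE yE zE wE; ring.
Qed.

Lemma sum4sq_prime (p : nat) : prime p -> sum4sq p.
Proof.
move=> p_pr; case: (even_prime p_pr) => [->|p_odd].
  by exists 1, 1, 0, 0.
have [a [b [a_lt b_lt /dvdnP [m mE]]]] := prime_dvd_sqrD1 p_pr p_odd.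
apply: (@sum4sq_descent p m) => //.
  have p_gt1 := prime_gt1 p_pr; apply/andP; split.
    by case: m mE => //; rewrite mul0n addn1.
  rewrite -(ltn_pmul2r (ltnW p_gt1)) -mE -!mulnn; clear -a_lt b_lt p_gt1.
  have := leq_mul a_lt a_lt; have := leq_mul b_lt b_lt.
  have := leq_mul p_gt1 p_gt1; clear; lia.
by exists a, b, 1, 0; rewrite -mE -!mulnn !PoszD !PoszM; ring.
Qed.

Lemma sum4sq_nat (n : nat) : sum4sq n.
Proof.
elim/ltn_ind: n => n IH.
case: (ltnP 1 n) => [n_gt1|]; last first.
  case: n {IH} => [|[|//]] _; [by exists 0, 0, 0, 0 | by exists 1, 0, 0, 0].
rewrite -(divnK (pdiv_dvd n)) PoszM; apply: sum4sqM.
  by apply: IH; apply: ltn_Pdiv; [apply/prime_gt1/pdiv_prime | apply: ltnW].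
exact/sum4sq_prime/pdiv_prime.
Qed.

(** * Reflections *)

Lemma mod3_unit (b x : int) : ~~ (3 %| b)%Z ->
  exists t, x = 3 * t \/ x = 3 * t + b \/ x = 3 * t - b.
Proof.
move=> b3; have [H|[H|H]] : (3 %| x \/ 3 %| x - b \/ 3 %| x + b)%Z by lia.
- by exists (x %/ 3)%Z; lia.
- by exists ((x - b) %/ 3)%Z; lia.
- by exists ((x + b) %/ 3)%Z; lia.
Qed.

Definition unavoidable (rho n : int) : Prop := forall x y z w : int,
  x ^+ 2 + y ^+ 2 + z ^+ 2 + w ^+ 2 = n ->
  (x = rho \/ x = - rho) \/ (y = rho \/ y = - rho) \/
  (z = rho \/ z = - rho) \/ (w = rho \/ w = - rho).

(* The condition for the reflection in the v supported on the entries rho,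
   rho + 3 q, rho + 3 r to produce an entry rho or - rho among these three; the
   two other line predicates below play the same role for other residues. *)
Definition units_line (rho q r : int) : Prop :=
  q + r = 0 \/ q + r = - rho \/ q - 2 * r = 0 \/ q - 2 * r = 2 * rho \/
  r - 2 * q = 0 \/ r - 2 * q = 2 * rho.

Lemma units_line_of_unavoidable (rho n x q r : int) :
  unavoidable rho n -> x != rho -> x != - rho ->
  x ^+ 2 + rho ^+ 2 + (rho + 3 * q) ^+ 2 + (rho + 3 * r) ^+ 2 = n ->
  units_line rho q r.
Proof.
move=> U x1 x2 E; rewrite /units_line.
have {U} := U x (rho - 2 * (rho + q + r)) (rho + 3 * q - 2 * (rho + q + r))
  (rho + 3 * r - 2 * (rho + q + r)) ltac:(rewrite -E; ring).
clear E; lia.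
Qed.

Lemma units_line_bound (rho p q r : int) : 0 < rho ->
  units_line rho p q -> units_line rho p r -> units_line rho q r ->
  -6 * rho <= p <= 4 * rho /\
  (p < -4 * rho ->
     -4 * rho <= q <= rho /\ -4 * rho <= r <= rho).
Proof. by rewrite /units_line => rho0 H1 H2 H3; split=> [|p4]; lia. Qed.

Lemma units_lineC (rho q r : int) : units_line rho q r -> units_line rho r q.
Proof. by rewrite /units_line; lia. Qed.

Lemma units_line0_bound (rho u v : int) : 0 < rho ->
  units_line rho 0 u -> units_line rho 0 v ->
  rho ^+ 2 + rho ^+ 2 + (rho + 3 * u) ^+ 2 + (rho + 3 * v) ^+ 2
    < 550 * rho ^+ 2.
Proof.
rewrite /units_line => rho0 Hu Hv; have rho2 := exprn_gt0 2 rho0.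
have := @sqr_le_of_between (7 * rho) (rho + 3 * u) ltac:(lia).
have := @sqr_le_of_between (7 * rho) (rho + 3 * v) ltac:(lia).
by lia.
Qed.

(* The largest norm, 475 rho^2, is attained at the permutations of
   rho * (1, -8, -11, -17). *)
Lemma units_line3_bound (rho p q r : int) : 0 < rho ->
  units_line rho p q -> units_line rho p r -> units_line rho q r ->
  rho ^+ 2 + (rho + 3 * p) ^+ 2 + (rho + 3 * q) ^+ 2 + (rho + 3 * r) ^+ 2
    < 550 * rho ^+ 2.
Proof.
move=> rho0; have rho2 := exprn_gt0 2 rho0.
have sorted u v w : u <= v -> u <= w ->
    units_line rho u v -> units_line rho u w -> units_line rho v w ->
    rho ^+ 2 + (rho + 3 * u) ^+ 2 + (rho + 3 * v) ^+ 2 + (rho + 3 * w) ^+ 2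
      < 550 * rho ^+ 2.
  move=> le_uv le_uw uv uw vw.
  have [bu low] := units_line_bound rho0 uv uw vw.
  have [bv _] := units_line_bound rho0 (units_lineC uv) vw uw.
  have [bw _] := units_line_bound rho0 (units_lineC uw) (units_lineC vw) uv.
  case: (ltrP u (-4 * rho)) => [/low [cv cw]|u4].
    have := @sqr_le_of_between (17 * rho) (rho + 3 * u) ltac:(lia).
    have := @sqr_le_of_between (11 * rho) (rho + 3 * v) ltac:(lia).
    have := @sqr_le_of_between (11 * rho) (rho + 3 * w) ltac:(lia).
    by lia.
  have := @sqr_le_of_between (13 * rho) (rho + 3 * u) ltac:(lia).
  have := @sqr_le_of_between (13 * rho) (rho + 3 * v) ltac:(lia).
  have := @sqr_le_of_between (13 * rho) (rho + 3 * w) ltac:(lia).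
  by lia.
move=> pq pr qr.
have [qp rp rq] := And3 (units_lineC pq) (units_lineC pr) (units_lineC qr).
case: (lerP p q) => [le_pq|/ltW le_qp].
  case: (lerP p r) => [le_pr|/ltW le_rp]; first exact: sorted.
  by have := sorted r p q le_rp (le_trans le_rp le_pq) rp rq pq; lia.
case: (lerP q r) => [le_qr|/ltW le_rq].
  by have := sorted q p r le_qp le_qr qp qr pr; lia.
by have := sorted r p q (le_trans le_rq le_qp) le_rq rp rq pq; lia.
Qed.

Lemma unavoidable_units (rho n p q r : int) :
  0 < rho -> ~~ (3 %| rho)%Z -> 550 * rho ^+ 2 <= n -> unavoidable rho n ->
  rho ^+ 2 + (rho + 3 * p) ^+ 2 + (rho + 3 * q) ^+ 2 + (rho + 3 * r) ^+ 2 = n ->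
  p = 0 /\ q = 0 \/ p = 0 /\ r = 0 \/ q = 0 /\ r = 0.
Proof.
move=> rho0 rho3 n_ge U E.
have line u v w : rho ^+ 2 + (rho + 3 * u) ^+ 2 + (rho + 3 * v) ^+ 2
    + (rho + 3 * w) ^+ 2 = n -> u <> 0 -> units_line rho v w.
  move=> F u0; apply: (@units_line_of_unavoidable rho n (rho + 3 * u) v w U).
  - by clear -u0; lia.
  - by clear -rho3; lia.
  - by rewrite -F; ring.
have Hp := line p q r E.
have Hq := line q p r ltac:(rewrite -E; ring).
have Hr := line r p q ltac:(rewrite -E; ring).
move: n_ge; rewrite -E; clear E U line.
case: (eqVneq p 0) Hp => [p0 _|/eqP p0 /(_ p0) Hp];
  case: (eqVneq q 0) Hq => [q0 _|/eqP q0 /(_ q0) Hq];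
  case: (eqVneq r 0) Hr => [r0 _|/eqP r0 /(_ r0) Hr]; try subst; try by tauto.
- by have := units_line0_bound rho0 Hr Hq; lia.
- by have := units_line0_bound rho0 (units_lineC Hr) Hp; lia.
- by have := units_line0_bound rho0 (units_lineC Hq) (units_lineC Hp); lia.
- by have := units_line3_bound rho0 Hr Hq Hp; lia.
Qed.

Definition unit_zero_line (rho p r : int) : Prop :=
  r = p \/ r = p + rho \/ 2 * r = - p \/ 2 * r = - p - 2 * rho \/
  r = - 2 * p + rho \/ r = - 2 * p - rho.

Lemma unit_zero_line_of_unavoidable (rho n x p r : int) :
  unavoidable rho n -> x != rho -> x != - rho ->
  x ^+ 2 + rho ^+ 2 + (rho + 3 * p) ^+ 2 + (3 * r) ^+ 2 = n ->
  unit_zero_line rho p r /\ unit_zero_line rho p (- r).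
Proof.
move=> U x1 x2 E; rewrite /unit_zero_line; split.
  have {U} := U x (rho + 2 * (p - r)) (rho + 3 * p - 2 * (p - r))
    (3 * r + 2 * (p - r)) ltac:(rewrite -E; ring).
  by clear E; lia.
have {U} := U x (rho + 2 * (p + r)) (rho + 3 * p - 2 * (p + r))
  (3 * r - 2 * (p + r)) ltac:(rewrite -E; ring).
by clear E; lia.
Qed.

Lemma unit_zero_line_bound (rho p r : int) : 0 < rho ->
  unit_zero_line rho p r -> unit_zero_line rho p (- r) ->
  (rho + 3 * p) ^+ 2 <= (13 * rho) ^+ 2 /\ (3 * r) ^+ 2 <= (13 * rho) ^+ 2.
Proof.
by rewrite /unit_zero_line => rho0 H1 H2; split; apply: sqr_le_of_between; lia.
Qed.

Lemma avoidable_two_units (rho n p q r : int) :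
  0 < rho -> ~~ (3 %| rho)%Z -> 550 * rho ^+ 2 <= n -> unavoidable rho n ->
  rho ^+ 2 + (rho + 3 * p) ^+ 2 + (3 * q) ^+ 2 + (3 * r) ^+ 2 = n -> False.
Proof.
move=> rho0 rho3 n_ge U E; have rho2 := exprn_gt0 2 rho0.
have [] := @unit_zero_line_of_unavoidable rho n (3 * r) p q U
  ltac:(lia) ltac:(lia) ltac:(rewrite -E; ring).
move=> /(unit_zero_line_bound rho0) /[apply] [[_ bq]].
have [] := @unit_zero_line_of_unavoidable rho n (3 * q) p r U
  ltac:(lia) ltac:(lia) ltac:(rewrite -E; ring).
move=> /(unit_zero_line_bound rho0) /[apply] [[bp br]].
by clear U; lia.
Qed.

Lemma unavoidable_three_units (rho n p q r : int) :
  0 < rho -> ~~ (3 %| rho)%Z -> 550 * rho ^+ 2 <= n -> unavoidable rho n ->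
  rho ^+ 2 + (rho + 3 * p) ^+ 2 + (rho + 3 * q) ^+ 2 + (3 * r) ^+ 2 = n ->
  p = 0 /\ q = 0.
Proof.
move=> rho0 rho3 n_ge U E; have rho2 := exprn_gt0 2 rho0.
have bound u v : u <> 0 ->
    rho ^+ 2 + (rho + 3 * u) ^+ 2 + (rho + 3 * v) ^+ 2 + (3 * r) ^+ 2 = n ->
    (rho + 3 * v) ^+ 2 <= (13 * rho) ^+ 2 /\ (3 * r) ^+ 2 <= (13 * rho) ^+ 2.
  move=> u0 F; have [] := @unit_zero_line_of_unavoidable rho n (rho + 3 * u) v r
    U
    ltac:(lia) ltac:(lia) ltac:(rewrite -F; ring).
  exact: unit_zero_line_bound.
have line := @units_line_of_unavoidable rho n (3 * r) p q U
  ltac:(lia) ltac:(lia) ltac:(rewrite -E; ring).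
have E' : rho ^+ 2 + (rho + 3 * q) ^+ 2 + (rho + 3 * p) ^+ 2 + (3 * r) ^+ 2 = n.
  by rewrite -E; ring.
have bq p0 := bound p q p0 E; have bp q0 := bound q p q0 E'.
case: (eqVneq p 0) bq => [p0 _|/eqP p0 /(_ p0) [bq br]];
  case: (eqVneq q 0) bp => [q0 _|/eqP q0 /(_ q0) [bp br']] //; exfalso.
- rewrite p0 in line.
  have := @sqr_le_of_between (7 * rho) (rho + 3 * q)
    ltac:(move: line; rewrite /units_line; clear -rho0; lia).
  by clear U line bound; lia.
- rewrite q0 in line.
  have := @sqr_le_of_between (7 * rho) (rho + 3 * p)
    ltac:(move: line; rewrite /units_line; clear -rho0; lia).
  by clear U line bound; lia.
- by clear U line bound; lia.
Qed.

Lemma avoidable_three_units (rho n p q r : int) :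
  0 < rho -> ~~ (3 %| rho)%Z -> 550 * rho ^+ 2 <= n -> unavoidable rho n ->
  rho ^+ 2 + (rho + 3 * p) ^+ 2 + (rho + 3 * q) ^+ 2 + (3 * r) ^+ 2 = n ->
  False.
Proof.
move=> rho0 rho3 n_ge U E; have rho2 := exprn_gt0 2 rho0.
have three u v w := @unavoidable_three_units rho n u v w rho0 rho3 n_ge U.
have [p0 q0] := three p q r E; subst p q.
have [t [|[|]] rE] := mod3_unit r rho3; rewrite {}rE in E.
- have := three (- 2 * t) (2 * t) t ltac:(rewrite -E; ring).
  by clear U three; nia.
- have := three (2 * t) t (rho + 2 * t) ltac:(rewrite -E; ring).
  by clear U three; nia.
- have := three (- 2 * t) (- t) (rho - 2 * t) ltac:(rewrite -E; ring).
  by clear U three; nia.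
Qed.

Definition zero_units_line (rho b p : int) : Prop :=
  p = rho \/ p = -2 * rho \/ b + 2 * p = 5 * rho \/ b + 2 * p = - rho \/
  b + p = rho \/ b + p = -5 * rho.

Lemma zero_units_lines (rho n x b p : int) :
  unavoidable (3 * rho) n -> x != 3 * rho -> x != - (3 * rho) ->
  x ^+ 2 + (3 * rho) ^+ 2 + b ^+ 2 + (b + 3 * p) ^+ 2 = n ->
  zero_units_line rho b p /\ zero_units_line (- rho) b p.
Proof.
move=> U x1 x2 E; rewrite /zero_units_line; split.
  have {U} := U x (3 * rho - 2 * (rho - p)) (b - 2 * (rho - p))
    (b + 3 * p + 2 * (rho - p)) ltac:(rewrite -E; ring).
  by clear E; lia.
have {U} := U x (- 3 * rho + 2 * (rho + p)) (b + 2 * (rho + p))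
    (b + 3 * p - 2 * (rho + p)) ltac:(rewrite -E; ring).
by clear E; lia.
Qed.

Lemma zero_units_bound (rho b p : int) : 0 < rho ->
  zero_units_line rho b p -> zero_units_line (- rho) b p ->
  - (11 * rho) <= b <= 11 * rho /\ - (11 * rho) <= b + 3 * p <= 11 * rho /\
   - (6 * rho) <= p <= 6 * rho.
Proof.
by rewrite /zero_units_line => rho0 H1 H2; repeat split; lia.
Qed.

Lemma avoidable_one_zero (rho n b p q : int) :
  0 < rho -> ~~ (3 %| b)%Z -> 550 * (3 * rho) ^+ 2 <= n ->
  unavoidable (3 * rho) n ->
  (3 * rho) ^+ 2 + b ^+ 2 + (b + 3 * p) ^+ 2 + (b + 3 * q) ^+ 2 = n -> False.
Proof.
move=> rho0 b3 n_ge U E; have rho2 := exprn_gt0 2 rho0.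
have [|||p1 p2] := @zero_units_lines rho n (b + 3 * q) b p U;
  [lia | lia | by rewrite -E; ring |].
have [|||q1 q2] := @zero_units_lines rho n (b + 3 * p) b q U;
  [lia | lia | by rewrite -E; ring |].
have [bb [bp _]] := zero_units_bound rho0 p1 p2.
have [_ [bq _]] := zero_units_bound rho0 q1 q2.
have {}bb := sqr_le_of_between bb.
have {}bp := sqr_le_of_between bp.
have {}bq := sqr_le_of_between bq.
by clear U; lia.
Qed.

Lemma large_of_sqr (k x : int) : 0 <= k -> k ^+ 2 < x ^+ 2 -> x < - k \/ k < x.
Proof.
move=> k0 kx; case: (lerP x k) => [xk|]; last by right.
case: (lerP (- k) x) => [kx'|]; last by left.
have := @sqr_le_of_between k x ltac:(lia); lia.
Qed.

Lemma unavoidable_two_zeros (rho n b p d : int) :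
  0 < rho -> ~~ (3 %| b)%Z -> 550 * (3 * rho) ^+ 2 <= n ->
  unavoidable (3 * rho) n ->
  (3 * rho) ^+ 2 + b ^+ 2 + (b + 3 * p) ^+ 2 + (3 * d) ^+ 2 = n ->
  d = rho \/ d = - rho.
Proof.
move=> rho0 b3 n_ge U E; have rho2 := exprn_gt0 2 rho0.
have small c q e : e <> rho -> e <> - rho ->
    (3 * rho) ^+ 2 + c ^+ 2 + (c + 3 * q) ^+ 2 + (3 * e) ^+ 2 = n ->
   - (11 * rho) <= c <= 11 * rho /\ - (11 * rho) <= c + 3 * q <= 11 * rho /\
   - (6 * rho) <= q <= 6 * rho.
  move=> e1 e2 F.
  have [|||p1 p2] := @zero_units_lines rho n (3 * e) c q U;
    [by clear -e1; lia | by clear -e2; lia | by rewrite -F; ring |].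
  exact: zero_units_bound.
case: (eqVneq d rho) => [|/eqP d1]; first by left.
case: (eqVneq d (- rho)) => [|/eqP d2]; first by right.
have [bb [bc bp]] := small b p d d1 d2 E.
exfalso.
have d22 : d < - (22 * rho) \/ 22 * rho < d.
  apply: large_of_sqr; first by clear -rho0; lia.
  have sb := sqr_le_of_between bb; have sc := sqr_le_of_between bc.
  move: E n_ge sb sc rho2; rewrite !exprMn; clear.
  move: (b ^+ 2) ((b + 3 * p) ^+ 2) (d ^+ 2) (rho ^+ 2) => ? ? ? ?; lia.
(* Reflect in v = (0, 1, -1, 1), so that (x . v) / 3 = d - p. *)
have [t dE] := mod3_unit (d - p) b3.
have {dE} : d = p + 3 * t \/ d = p + 3 * t + b \/ d = p + 3 * t - b.
  by clear -dE; lia.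
case=> [|[|]] dE; rewrite {}dE in E d22.
- have := small (b - 6 * t) (p + 4 * t) (p + t)
    ltac:(clear -bp d22; lia) ltac:(clear -bp d22; lia)
    ltac:(rewrite -E; ring).
  by clear -bb bc bp d22; lia.
- have := small (b + 6 * t) (p - t) (b + p + 2 * t)
    ltac:(clear -bb bp d22; lia) ltac:(clear -bb bp d22; lia)
    ltac:(rewrite -E; ring).
  by clear -bb bc bp d22; lia.
- have := small (- b + 3 * p + 6 * t) (- t) (b - 2 * t)
    ltac:(clear -bb bp d22; lia) ltac:(clear -bb bp d22; lia)
    ltac:(rewrite -E; ring).
  by clear -bb bc bp d22; lia.
Qed.

Lemma avoidable_two_zeros (rho n b p d : int) :
  0 < rho -> ~~ (3 %| b)%Z -> 550 * (3 * rho) ^+ 2 <= n ->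
  unavoidable (3 * rho) n ->
  (3 * rho) ^+ 2 + b ^+ 2 + (b + 3 * p) ^+ 2 + (3 * d) ^+ 2 = n -> False.
Proof.
move=> rho0 b3 n_ge U E; have rho2 := exprn_gt0 2 rho0.
have dE : (3 * d) ^+ 2 = (3 * rho) ^+ 2.
  by have [->|->] := unavoidable_two_zeros rho0 b3 n_ge U E; ring.
have line e : e = rho \/ e = - rho -> zero_units_line e b p.
  move=> eE; have e2 : (3 * rho) ^+ 2 = (3 * e) ^+ 2 by case: eE => ->; ring.
  have zero c q f c3 := @unavoidable_two_zeros rho n c q f rho0 c3 n_ge U.
  have [t tE] := mod3_unit (e - p) b3.
  have {tE} : p = e - 3 * t \/ p = e - b - 3 * t \/ p = e + b - 3 * t.
    by clear -tE; lia.
  rewrite /zero_units_line; case=> [|[|]] pE; rewrite {}pE in E *.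
  - have := zero (b - 6 * t) (e + t) (e - 2 * t) ltac:(clear -b3; lia)
      ltac:(rewrite -E dE e2; ring).
    by clear -eE; lia.
  - have := zero (b + 6 * t) (e - b - 4 * t) (e - t) ltac:(clear -b3; lia)
      ltac:(rewrite -E dE e2; ring).
    by clear -eE; lia.
  - have := zero (2 * b + 3 * e - 3 * t) (- t) (b - 2 * t) ltac:(clear -b3; lia)
      ltac:(rewrite -E dE e2; ring).
    by clear -eE; lia.
have [bb [bc _]] := zero_units_bound rho0
  (line rho ltac:(by left)) (line (- rho) ltac:(by right)).
have {}bb := sqr_le_of_between bb.
have {}bc := sqr_le_of_between bc.
move: E n_ge bb bc rho2; rewrite dE !exprMn; clear.
move: (b ^+ 2) ((b + 3 * p) ^+ 2) (rho ^+ 2) => ? ? ?; lia.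
Qed.

Lemma avoidable_cube (rho n e : int) :
  0 < rho -> ~~ (3 %| rho)%Z -> 550 * rho ^+ 2 <= n -> unavoidable rho n ->
  rho ^+ 2 + rho ^+ 2 + rho ^+ 2 + (rho + 3 * e) ^+ 2 = n -> False.
Proof.
move=> rho0 rho3 n_ge U E; have rho2 := exprn_gt0 2 rho0.
have units p q r := @unavoidable_units rho n p q r rho0 rho3 n_ge U.
suff small : - (23 * rho) <= rho + 3 * e <= 23 * rho.
  by have := sqr_le_of_between small; clear -E n_ge rho2; lia.
have [t [|[]]] := mod3_unit e rho3 => eE; rewrite {}eE in E *.
- have := units (2 * t) (2 * t) (- t) ltac:(rewrite -E; ring).
  by clear -rho0; lia.
- have [s [|[]]] := mod3_unit t rho3 => tE; rewrite {}tE in E *.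
  + have := units (4 * s) (4 * s) (rho + 7 * s) ltac:(rewrite -E; ring).
    by clear -rho0; lia.
  + have := units (- 4 * rho - 8 * s) (2 * rho + 4 * s) s
      ltac:(rewrite -E; ring).
    by clear -rho0; lia.
  + have := units (8 * s - 2 * rho) (- 4 * s) (- s) ltac:(rewrite -E; ring).
    by clear -rho0; lia.
- have := units (- 2 * t) (- 2 * t) (t - rho) ltac:(rewrite -E; ring).
  by clear -rho0; lia.
Qed.

Lemma avoidable_units (rho n p q r : int) :
  0 < rho -> ~~ (3 %| rho)%Z -> 550 * rho ^+ 2 <= n -> unavoidable rho n ->
  rho ^+ 2 + (rho + 3 * p) ^+ 2 + (rho + 3 * q) ^+ 2 + (rho + 3 * r) ^+ 2 = n ->
  False.
Proof.
move=> rho0 rho3 n_ge U E.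
have cube e := @avoidable_cube rho n e rho0 rho3 n_ge U.
have := unavoidable_units rho0 rho3 n_ge U E.
by case=> [|[|]] [eq0 eq0']; rewrite eq0 eq0' in E;
  [apply: (cube r) | apply: (cube q) | apply: (cube p)]; rewrite -E; ring.
Qed.

Definition sum3units (m : int) : Prop := exists x y z : int,
  [/\ ~~ (3 %| x)%Z, ~~ (3 %| y)%Z, ~~ (3 %| z)%Z
    & x ^+ 2 + y ^+ 2 + z ^+ 2 = m].

Lemma sum3units_nine_sum (x y z : int) :
  ~~ (3 %| x + y + z)%Z -> sum3units (9 * (x ^+ 2 + y ^+ 2 + z ^+ 2)).
Proof.
move=> s3; exists (x - 2 * y - 2 * z), (y - 2 * x - 2 * z), (z - 2 * x - 2 * y).
by split; [lia | lia | lia | ring].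
Qed.

Lemma sum3units_nine (x y z : int) :
  ~~ (3 %| x)%Z || ~~ (3 %| y)%Z || ~~ (3 %| z)%Z ->
  sum3units (9 * (x ^+ 2 + y ^+ 2 + z ^+ 2)).
Proof.
move=> xyz.
have [s|[s|[s|s]]] : ~~ (3 %| x + y + z)%Z \/ ~~ (3 %| x + y - z)%Z \/
   ~~ (3 %| x - y + z)%Z \/ ~~ (3 %| x - y - z)%Z by lia.
- exact: sum3units_nine_sum.
- by rewrite -(sqrrN z); exact: sum3units_nine_sum.
- by rewrite -(sqrrN y); exact: sum3units_nine_sum.
- by rewrite -(sqrrN y) -(sqrrN z); exact: sum3units_nine_sum.
Qed.

Lemma sum3units_nineM (x y z : int) :
  x ^+ 2 + y ^+ 2 + z ^+ 2 != 0 -> sum3units (9 * (x ^+ 2 + y ^+ 2 + z ^+ 2)).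
Proof.
have [k] := ubnP (`|x| + `|y| + `|z|)%N.
elim: k x y z => // k IH x y z lt_k nz.
case: (boolP (~~ (3 %| x)%Z || ~~ (3 %| y)%Z || ~~ (3 %| z)%Z)).
  exact: sum3units_nine.
rewrite !negb_or !negbK => /andP[/andP[/dvdzP[a xE] /dvdzP[b yE]] /dvdzP[c zE]].
have sE : x ^+ 2 + y ^+ 2 + z ^+ 2 = 9 * (a ^+ 2 + b ^+ 2 + c ^+ 2).
  by rewrite xE yE zE; ring.
have nz' : a ^+ 2 + b ^+ 2 + c ^+ 2 != 0.
  by apply: contra nz; rewrite sE => /eqP ->.
have [||u [v [w [u3 _ _ uvw]]]] // := IH a b c.
  have : x <> 0 \/ y <> 0 \/ z <> 0.
    case: (eqVneq x 0) nz => [->|/eqP]; last by left.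
    case: (eqVneq y 0) => [->|/eqP]; last by right; left.
    by case: (eqVneq z 0) => [->|/eqP]; [rewrite expr0n | right; right].
  by clear nz nz' sE; lia.
by rewrite sE -uvw; apply: sum3units_nine; rewrite u3.
Qed.

Lemma sqr_unit3 (b x : int) : ~~ (3 %| b)%Z -> ~~ (3 %| x)%Z ->
  exists p, x ^+ 2 = (b + 3 * p) ^+ 2.
Proof.
move=> b3 x3; have [t [|[]] xE] := mod3_unit x b3.
- by case/negP: x3; rewrite xE dvdz_mulr.
- by exists t; rewrite xE; ring.
- by exists (- t); rewrite xE; ring.
Qed.

Lemma dvdz3_mul (x : int) : (3 %| x)%Z -> exists q, x = 3 * q.
Proof. by case/dvdzP => q ->; exists q; rewrite mulrC. Qed.

Lemma unavoidable_rep (rho n : int) : 0 <= n -> unavoidable rho n ->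
  exists x y z : int, rho ^+ 2 + x ^+ 2 + y ^+ 2 + z ^+ 2 = n.
Proof.
case: n => // n _ U; have [x [y [z [w E]]]] := sum4sq_nat n.
have sqr (t : int) : t = rho \/ t = - rho -> rho ^+ 2 = t ^+ 2.
  by case=> ->; rewrite ?sqrrN.
case: (U x y z w E) => [/sqr xE|[/sqr yE|[/sqr zE|/sqr wE]]].
- by exists y, z, w; rewrite xE.
- by exists x, z, w; rewrite yE -E; ring.
- by exists x, y, w; rewrite zE -E; ring.
- by exists x, y, z; rewrite wE -E; ring.
Qed.

Lemma avoidable_unit (rho n : int) :
  0 < rho -> ~~ (3 %| rho)%Z -> 550 * rho ^+ 2 <= n -> ~ unavoidable rho n.
Proof.
move=> rho0 rho3 n_ge U; have rho2 := exprn_gt0 2 rho0.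
have units p q r := @avoidable_units rho n p q r rho0 rho3 n_ge U.
have three p q r := @avoidable_three_units rho n p q r rho0 rho3 n_ge U.
have two p q r := @avoidable_two_units rho n p q r rho0 rho3 n_ge U.
have unit3 := sqr_unit3 rho3.
have [|x [y [z E]]] := unavoidable_rep _ U; first by clear -n_ge rho2; lia.
case: (boolP (3 %| x)%Z) => [/dvdz3_mul|/unit3] [p pE];
  case: (boolP (3 %| y)%Z) => [/dvdz3_mul|/unit3] [q qE];
  case: (boolP (3 %| z)%Z) => [/dvdz3_mul|/unit3] [r rE];
  rewrite pE qE rE in E.
- have : p ^+ 2 + q ^+ 2 + r ^+ 2 != 0.
    apply/eqP => s0; move: n_ge; rewrite -E !exprMn -!addrA -!mulrDr addrA s0.
    by clear -rho2; lia.
  case/sum3units_nineM => a [b [c [/unit3 [i iE] /unit3 [j jE]]]].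
  move=> /unit3 [k kE] abc.
  apply: (units i j k); rewrite -iE -jE -kE -E.
  by transitivity (rho ^+ 2 + (a ^+ 2 + b ^+ 2 + c ^+ 2));
    [ring | rewrite abc; ring].
- by apply: (two r p q); rewrite -E; ring.
- by apply: (two q p r); rewrite -E; ring.
- by apply: (three q r p); rewrite -E; ring.
- by apply: (two p q r); rewrite -E; ring.
- by apply: (three p r q); rewrite -E; ring.
- by apply: (three p q r); rewrite -E; ring.
- exact: (units p q r).
Qed.

Lemma unavoidable_triple (rho n : int) :
  unavoidable (3 * rho) (9 * n) -> unavoidable rho n.
Proof.
move=> U x y z w E.
have := U (3 * x) (3 * y) (3 * z) (3 * w) ltac:(rewrite -E; ring).
by clear; lia.
Qed.

Lemma avoidable (rho n : int) :
  0 < rho -> 550 * rho ^+ 2 <= n -> ~ unavoidable rho n.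
Proof.
have [k] := ubnP `|rho|%N; elim: k rho n => // k IH rho n lt_k rho0.
case: (boolP (3 %| rho)%Z) => [/dvdz3_mul [s sE]|]; last exact: avoidable_unit.
rewrite {}sE in lt_k rho0 *; have {}rho0 : 0 < s by clear -rho0; lia.
move=> n_ge U; have s2 := exprn_gt0 2 rho0.
have one b x y : ~~ (3 %| b)%Z ->
    (3 * s) ^+ 2 + b ^+ 2 + (3 * x) ^+ 2 + (3 * y) ^+ 2 = n -> False.
  move=> b3 E.
  have /sum3units_nineM [u [v [w [u3 v3 w3 uvw]]]] :
      s ^+ 2 + x ^+ 2 + y ^+ 2 != 0.
    by have := sqr_ge0 x; have := sqr_ge0 y; clear -s2; lia.
  have := U b u v w ltac:(transitivity (b ^+ 2 + (u ^+ 2 + v ^+ 2 + w ^+ 2));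
    [ring | rewrite uvw -E; ring]).
  by clear -b3 u3 v3 w3; lia.
have two b c x : ~~ (3 %| b)%Z -> ~~ (3 %| c)%Z ->
    (3 * s) ^+ 2 + b ^+ 2 + c ^+ 2 + (3 * x) ^+ 2 = n -> False.
  move=> b3 /(sqr_unit3 b3) [p ->]; exact: avoidable_two_zeros.
have [|x [y [z E]]] := unavoidable_rep _ U; first by clear -n_ge s2; lia.
case: (boolP (3 %| x)%Z) => [/dvdz3_mul [p pE]|x3];
  case: (boolP (3 %| y)%Z) => [/dvdz3_mul [q qE]|y3];
  case: (boolP (3 %| z)%Z) => [/dvdz3_mul [r rE]|z3]; subst.
- apply: (IH s (s ^+ 2 + p ^+ 2 + q ^+ 2 + r ^+ 2)) => //.
  + by clear -lt_k rho0; lia.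
  + by clear -n_ge; lia.
  + by apply: unavoidable_triple; move: U; congr unavoidable; ring.
- by apply: (one z p q) => //; ring.
- by apply: (one y p r) => //; ring.
- by apply: (two y z p) => //; ring.
- by apply: (one x q r) => //; ring.
- by apply: (two x z q) => //; ring.
- by apply: (two x y r) => //; ring.
- have [p pE] := sqr_unit3 x3 y3; have [q qE] := sqr_unit3 x3 z3.
  by rewrite pE qE in n_ge U; apply: (avoidable_one_zero rho0 x3 n_ge U).
Qed.

Lemma avoiding_rep (r m : nat) : (0 < r)%N -> (550 * r ^ 2 <= m)%N ->
  exists x y z w : nat,
    [/\ (x ^ 2 + y ^ 2 + z ^ 2 + w ^ 2)%N = m, x != r, y != r, z != r & w != r].
Proof.
move=> r0 m_ge.
pose good (x y z w : 'I_m.+1) := [&& (x ^ 2 + y ^ 2 + z ^ 2 + w ^ 2)%N == m,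
  x != r :> nat, y != r :> nat, z != r :> nat & w != r :> nat].
case: (boolP [exists x, exists y, exists z, exists w, good x y z w]).
  case/existsP=> x /existsP[y /existsP[z /existsP[w /and5P[/eqP E]]]] *.
  by exists x, y, z, w.
move=> none; case: (@avoidable r%:Z m%:Z) => [|| x y z w E]; [lia|lia|].
have {}E : (`|x| ^ 2 + `|y| ^ 2 + `|z| ^ 2 + `|w| ^ 2 = m)%N.
  apply/eqP; rewrite -eqz_nat !PoszD -E -!abszX.
  by rewrite !gez0_abs ?sqr_ge0.
have lt_m (t : nat) : (t ^ 2 <= m)%N -> (t < m.+1)%N.
  rewrite ltnS => /(leq_trans _) -> //.
  by rewrite -mulnn; case: t => // t; rewrite leq_pmulr.
have [xm ym zm wm] :
    [/\ `|x| < m.+1, `|y| < m.+1, `|z| < m.+1 & `|w| < m.+1]%N.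
  by split; apply: lt_m; rewrite -E; clear; lia.
move/existsPn/(_ (Ordinal xm))/existsPn/(_ (Ordinal ym)): none.
move/existsPn/(_ (Ordinal zm))/existsPn/(_ (Ordinal wm)).
rewrite /good /= E eqxx /=.
clear; lia.
Qed.

Theorem theorem2p1 (rho : int) (rho_gt0 : 0 < rho) (n : int)
    (n_ge : 550 * rho ^+ 2 <= n) :
  exists (k : nat) (x : 'I_k -> int),
    [/\ (k <= 4)%N, (forall i, x i \in S_ rho) & n = \sum_(i < k) x i ^+ 2].
Proof.
have [r rE] : exists r : nat, rho = r by exists `|rho|%N; lia.
have [m mE] : exists m : nat, n = m.
  by exists `|n|%N; have := exprn_gt0 2 rho_gt0; lia.
rewrite {}rE {}mE in rho_gt0 n_ge *.
have [||x [y [z [w [E xr yr zr wr]]]]] := @avoiding_rep r m; [lia|lia|].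
exists 4%N, (fun i => [:: x; y; z; w]`_i : int); split=> //.
  by case=> [[|[|[|[|]]]]] //= _; rewrite inE /= ?eqz_nat.
by rewrite !big_ord_recl big_ord0 /= -E addr0 !PoszD -!mulnn !PoszM !addrA.
Qed.
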